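(* Let $\hat D\subset\mathbb{C}^n$ be a set, let $D\subset\hat D$ be open, and let $\mathcal{X}$ be a Banach space of complex-valued functions on $\hat D$ that are analytic in $D$, satisfying Q1–Q3 over $\hat D$. Let $\mathcal{Y}$ be a topological vector space of complex-valued functions on a set $E$ such that $\Gamma_u g:=g(u)$, $g\in\mathcal{Y}$, defines a continuous linear functional on $\mathcal{Y}$ for every $u\in E$. Let $T:\mathcal{X}\to\mathcal{Y}$ be a continuous linear operator. Then the following are equivalent: (1) $T(e^{w\cdot z})$ is non-vanishing on $E$ for every $w\in\mathbb{C}^n$. (2) There exist a non-vanishing $a\in\mathcal{Y}$ and a map $b:E\to\hat D$ such that $Tf(u)=a(u)\,f(b(u))$ for every $f\in\mathcal{X}$ and $u\in E$. In this case $a=T(1)$ and $b=\frac{T(z)}{T(1)}$, where $T(z)$ denotes the $n$-tuple of functions $(T(z_i))_{i=1}^n$.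
   Context: $\mathcal{P}$ denotes the set of complex polynomials in $n$ variables, regarded as functions on $\hat D$. A Banach space $\mathcal{X}$ of complex-valued functions on a set $\hat D\subset\mathbb{C}^n$ satisfies Q1–Q3 over $\hat D$ if: (Q1) $\mathcal{P}$ is a dense subset of $\mathcal{X}$. (Q2) For every $z\in\hat D$ the point evaluation $\Lambda_z:\mathcal{X}\to\mathbb{C}$, $\Lambda_z f:=f(z)$, is a bounded linear functional on $\mathcal{X}$. Furthermore, if for some $z\in\mathbb{C}^n$ the map $p\mapsto p(z)$, $p\in\mathcal{P}$, extends to a bounded linear functional on all of $\mathcal{X}$, then $z\in\hat D$. (Q3) For every $1\le i\le n$ the shift operator $S_i:\mathcal{X}\to\mathcal{X}$, $(S_if)(z):=z_if(z)$, is a (well-defined) bounded linear operator. $e^{w\cdot z}$ denotes the function $z\mapsto \exp(\sum_{i=1}^n w_iz_i)$; under these assumptions it belongs to $\mathcal{X}$ for every $w\in\mathbb{C}^n$. $z_i$ denotes the $i$-th coordinate function. *)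

(* Defs.v *)
From HB Require Import structures.
From mathcomp Require Import all_boot all_order all_algebra.
From mathcomp Require Import finmap.
From mathcomp Require Import all_classical all_reals all_analysis.
From mathcomp.real_closed Require Export complex.
(* Not imported: the notations of mpoly clash with those of
   mathcomp-analysis, and summability redefines `summable`. *)
From mathcomp Require mpoly.
From mathcomp Require summability.

Set Implicit Arguments.
Unset Strict Implicit.
Unset Printing Implicit Defensive.

Import Order.TTheory GRing.Theory Num.Theory.
Import numFieldNormedType.Exports.

Local Open Scope classical_set_scope.
Local Open Scope ring_scope.

(* The complex numbers over the reals R.  The regular-algebra alias ^o is what
   gives access to the topology and the norm of the field R[i]; the norm takes
   its values in the nonnegative reals of R[i]. *)
Notation Cplx R := (R[i]^o)%type.

Section functions.
Context {R : realType} {n : nat}.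
Local Notation C := (Cplx R).

(* exp (x + i y) = e^x (cos y + i sin y) *)
Definition cexp (z : C) : C :=
  Complex (expR (complex.Re z) * cos (complex.Im z))
          (expR (complex.Re z) * sin (complex.Im z)).

Context (A : set 'rV[C]_n).

Definition polyfun (p : mpoly.mpoly n C) : A -> C :=
  fun z => mpoly.meval (val z 0) p.

Definition coordfun (i : 'I_n) : A -> C := fun z => val z 0 i.

Definition expfun (w : 'rV[C]_n) : A -> C :=
  fun z => cexp (\sum_(i < n) w 0 i * val z 0 i).

(* f is near every point of D the sum of an n-variable power series.  The sum
   over multi-indices is unconditional: the finite partial sums converge along
   the directed set of all finite sets of multi-indices. *)
Definition analytic_in (D : set 'rV[C]_n) (f : A -> C) : Prop :=
  forall z0 : 'rV[C]_n, D z0 ->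
  exists c : {ffun 'I_n -> nat} -> C,
  \forall z \near z0, forall x : A, val x = z ->
    summability.partial_sum
      (fun k : {ffun 'I_n -> nat} =>
         c k * \prod_(i < n) (z 0 i - z0 0 i) ^+ k i)
      @ summability.totally --> f x.

End functions.
Arguments polyfun {R n} A p.
Arguments coordfun {R n} A i.
Arguments expfun {R n} A w.

(* A vector space V of complex-valued functions on a set S is given by an
   abstract space V together with an injective linear map ev : V -> (S -> C)
   that sends an element of V to the function it is. *)
Section function_space.
Context {R : realType}.
Local Notation C := (Cplx R).

(* The element of V that is the function h; 0 if h does not belong to V. *)
Definition elt {V : lmodType R[i]} {S : Type} (ev : V -> S -> C)
  (h : S -> C) : V := xget 0 [set f | ev f = h].

Lemma eltE {V : lmodType R[i]} {S : Type} (ev : V -> S -> C) (f : V)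
  (h : S -> C) : injective ev -> ev f = h -> elt ev h = f.
Proof.
by move=> ev_inj evf; apply: ev_inj; rewrite evf /elt; case: xgetP => // /(_ f).
Qed.

Definition bounded_linear {V W : normedModType R[i]} (L : {linear V -> W}) :
  Prop := exists M : R[i], forall f : V, `|L f| <= M * `|f|.

End function_space.

Section Q1_Q3.
Context {R : realType} {n : nat}.
Local Notation C := (Cplx R).
Context (Dhat : set 'rV[C]_n) (X : normedModType R[i])
  (ev : {linear X -> (Dhat -> C)}).

Definition Q1 : Prop :=
  (forall p, exists f : X, ev f = polyfun Dhat p) /\
  dense [set f : X | exists p, ev f = polyfun Dhat p].

(* A functional extending p |-> p(z) forces p(z) to depend only on the
   restriction of p to Dhat, as it should. *)
Definition Q2 : Prop :=
  (forall z : Dhat, exists2 L : {linear X -> C},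
     bounded_linear L & forall f, L f = ev f z) /\
  (forall z : 'rV[C]_n,
     (exists2 L : {linear X -> C}, bounded_linear L &
        forall p (f : X), ev f = polyfun Dhat p ->
          L f = mpoly.meval (z 0) p) ->
     Dhat z).

Definition Q3 : Prop :=
  forall i : 'I_n, exists2 S : {linear X -> X}, bounded_linear S &
    forall f z, ev (S f) z = val z 0 i * ev f z.

Definition Q1_Q3 : Prop := [/\ Q1, Q2 & Q3].

End Q1_Q3.

(* Main.v *)
Require Import Defs.
From HB Require Import structures.
From mathcomp Require Import all_boot all_order all_algebra.
From mathcomp Require Import all_classical all_reals all_analysis.
From mathcomp Require Import ring lra.

Set Implicit Arguments.
Unset Strict Implicit.
Unset Printing Implicit Defensive.

Import Order.TTheory GRing.Theory Num.Theory.
Import numFieldNormedType.Exports.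

Local Open Scope classical_set_scope.
Local Open Scope ring_scope.

(** Fix u in E and let L f = T f (u), a continuous functional on X. The content
    is that if L vanishes at no exponential e^{w.z}, then L is a multiple of a
    point evaluation.

    Along a complex line, F(t) = L(e^{t (w.z)}) is the exponential series with
    coefficients lam_k = L((w.z)^k), and |lam_k| <= K M^k because the
    multiplications by the coordinates are bounded. So F is an entire function
    of exponential type without zeros, and Hadamard's factorization makes it
    lam_0 e^{t lam_1 / lam_0} ([hadamard_exp_type]). Hence
    L(e^{w.z}) = L(1) e^{w.b} for all w, where b_i = L(z_i) / L(1)
    ([functional_expfun]). Differentiating this identity in the direction of
    the i-th coordinate gives L(z_i e^{w.z}) = L(1) b_i e^{w.b}: the functional
    f |-> L(z_i f) satisfies an identity of the same form
    ([functional_shift]). Iterating, L(p) = L(1) p(b) for every polynomial p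
    ([functional_poly]). Therefore p |-> p(b) extends to the bounded functional
    L / L(1), so Q2 puts b in Dhat, and the density of the polynomials extends
    L(f) = L(1) f(b) to all of X. The converse and the formulas for a and b
    follow by evaluating the weighted composition at the exponentials, at 1 and
    at the coordinates.

    Hadamard's theorem is obtained here by polynomial arithmetic. The Taylor
    polynomials P_N of F converge to F uniformly on discs and F is bounded away
    from 0 on each disc by compactness, so that the zeros of P_N leave every
    disc: P_N(t) = lam_0 prod_j (1 - s_j t), with all |s_j| small once N is
    large. The growth bound on P_N, uniform in N, bounds the number of zeros in
    a disc of radius r by a constant times r ([zprod_count], an elementary form
    of Jensen's inequality), so that sum_j |s_j|^2 is small as well
    ([sum_sqr_count]). Since sum_j s_j = - lam_1 / lam_0, the product
    P_N(t) e^{- t lam_1 / lam_0} / lam_0 is prod_j (1 - s_j t) e^{s_j t}, whose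
    factors are 1 + O(|s_j t|^2); it tends both to 1 and to
    F(t) e^{- t lam_1 / lam_0} / lam_0. *)

(** * Real-valued norms over the complex numbers *)
Section real_norm.
Context {R : realType}.
Local Notation C := (Cplx R).
Implicit Types (V : normedModType R[i]) (a b : C) (r : R).

(** The norm of a normed module over R[i] takes its values in R[i], whose order
    is partial; estimates are made with its real part, which is all of it. *)
Definition rnorm {V} (x : V) : R := complex.Re `|x|.

Lemma rnormE V (x : V) : `|x| = (rnorm x)%:C%C :> R[i].
Proof. by rewrite /rnorm RRe_real// normr_real. Qed.

Lemma rnorm_ge0 V (x : V) : 0 <= rnorm x.
Proof. by rewrite -lecR -rnormE normr_ge0. Qed.

Lemma rnorm0 V : rnorm (0 : V) = 0.
Proof. by rewrite /rnorm normr0. Qed.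

Lemma rnorm_eq0 V (x : V) : (rnorm x == 0) = (x == 0).
Proof.
rewrite -(normr_eq0 x) rnormE; apply/eqP/eqP => [->//|].
by move=> /complexI.
Qed.

Lemma rnorm_gt0 V (x : V) : (0 < rnorm x) = (x != 0).
Proof. by rewrite lt_neqAle rnorm_ge0 andbT eq_sym rnorm_eq0. Qed.

Lemma rnormN V (x : V) : rnorm (- x) = rnorm x.
Proof. by rewrite /rnorm normrN. Qed.

Lemma rdistC V (x y : V) : rnorm (x - y) = rnorm (y - x).
Proof. by rewrite -rnormN opprB. Qed.

Lemma ler_rnormD V (x y : V) : rnorm (x + y) <= rnorm x + rnorm y.
Proof. by rewrite -lecR raddfD/= -!rnormE ler_normD. Qed.

Lemma ler_rnormB V (x y : V) : rnorm (x - y) <= rnorm x + rnorm y.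
Proof. by rewrite -(rnormN y) ler_rnormD. Qed.

Lemma ler_rdistD V (z x y : V) : rnorm (x - y) <= rnorm (x - z) + rnorm (z - y).
Proof. by rewrite -[x in X in X <= _](subrK z) -addrA ler_rnormD. Qed.

Lemma rnormZ V a (x : V) : rnorm (a *: x) = rnorm a * rnorm x.
Proof. by apply: complexI; rewrite rmorphM/= -!rnormE normrZ. Qed.

Lemma rnormM a b : rnorm (a * b : C) = rnorm a * rnorm b.
Proof. exact: (rnormZ (V := C)). Qed.

Lemma rnorm_real r : rnorm (r%:C%C : C) = `|r|.
Proof.
rewrite /rnorm/= /Num.norm/=; rewrite expr0n addr0 sqrtr_sqr//.
Qed.

Lemma rnorm1 : rnorm (1 : C) = 1.
Proof. by rewrite -[1]/(1%:C%C) rnorm_real normr1. Qed.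

Lemma rnormX a k : rnorm (a ^+ k : C) = rnorm a ^+ k.
Proof. by elim: k => [|k IH]; rewrite ?expr0 ?rnorm1// !exprS rnormM IH. Qed.

Lemma rnorm_nat k : rnorm (k%:R : C) = k%:R.
Proof.
rewrite -[in LHS](rmorph_nat (real_complex R)).
by rewrite rnorm_real ger0_norm.
Qed.

Lemma rnormV a : rnorm (a^-1 : C) = (rnorm a)^-1.
Proof.
have [->|a0] := eqVneq a 0; first by rewrite invr0 rnorm0 invr0.
have ra0 : rnorm a != 0 by rewrite rnorm_eq0.
by apply: (mulfI ra0); rewrite -rnormM mulfV// mulfV// rnorm1.
Qed.

Lemma ler_rnorm_sum V I (s : seq I) (P : pred I) (F : I -> V) :
  rnorm (\sum_(i <- s | P i) F i) <= \sum_(i <- s | P i) rnorm (F i).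
Proof.
elim/big_ind2: _ => [|x r y q xr yq|//]; first by rewrite rnorm0.
by rewrite (le_trans (ler_rnormD _ _))// lerD.
Qed.

Lemma rnorm_prod I (s : seq I) (P : pred I) (F : I -> C) :
  rnorm (\prod_(i <- s | P i) F i : C) = \prod_(i <- s | P i) rnorm (F i).
Proof. by apply: (big_morph _ rnormM rnorm1). Qed.

Lemma cvg_rnormP V (u : nat -> V) (l : V) :
  u @ \oo --> l <->
  forall e, 0 < e -> \forall n \near \oo, rnorm (l - u n) <= e.
Proof.
split=> [/cvgrPdist_le ul e e0|ul].
- have /ul : (0 : R[i]) < e%:C%C by rewrite ltcR.
  by apply: filterS => n; rewrite rnormE lecR.
- apply/cvgrPdist_le => e; rewrite ltcE/= => /andP[/eqP e0 ep].
  apply: filterS (ul _ ep) => n le.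
  by rewrite rnormE lecE/= e0 le andbT.
Qed.

Lemma cvg_rnorm_squeeze V (u : nat -> V) (l : V) (d : nat -> R) :
  (forall N, rnorm (l - u N) <= d N) -> d @ \oo --> (0 : R) -> u @ \oo --> l.
Proof.
move=> ud /cvgrPdist_le d0; apply/cvg_rnormP => e /d0.
apply: filterS => N; rewrite sub0r normrN; apply: le_trans.
by rewrite (le_trans (ud N))// ler_norm.
Qed.

Lemma rnorm_le_small V (x : V) : (forall e, 0 < e -> rnorm x <= e) -> x = 0.
Proof.
move=> xe; apply/eqP; rewrite -rnorm_eq0; apply: contraT => x0.
have x0' : 0 < rnorm x by rewrite lt_neqAle eq_sym x0 rnorm_ge0.
have h : 0 < rnorm x / 2 by rewrite divr_gt0.
by have := xe _ h; lra.
Qed.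

Lemma dense_rnorm V (A : set V) (f : V) e : dense A -> 0 < e ->
  exists2 g, A g & rnorm (f - g) < e.
Proof.
move=> dA e0; have e0' : (0 : R[i]) < e%:C%C by rewrite ltcR.
have [||g [fg Ag]] := dA (ball f e%:C%C).
- by exists f; exact: ballxx.
- exact: ball_open.
by exists g => //; move: fg; rewrite -ball_normE/= rnormE ltcR.
Qed.

Lemma cauchy_cvg_tail (V : completeNormedModType R[i]) (u : nat -> V)
    (tail : nat -> R) : tail @ \oo --> (0 : R) ->
  (forall m n, (m <= n)%N -> rnorm (u n - u m) <= tail m) ->
  exists l : V, u @ \oo --> l.
Proof.
move=> tail0 ut; suff : cvg (u @ \oo) by move=> /cvg_ex.
apply/cauchy_cvgP; apply/cauchy_exP => e; rewrite ltcE/= => /andP[/eqP e0 ep].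
have /cvgrPdist_lt /(_ _ ep) := tail0.
move=> [N _ /(_ N (leqnn N))/= tN].
exists (u N); suff : \forall n \near \oo, ball (u N) e (u n) by [].
exists N => //= n /= Nn.
rewrite -ball_normE/= rnormE ltcE/= e0 eqxx/=.
rewrite rdistC (le_lt_trans (ut _ _ Nn))//.
by apply: le_lt_trans tN; rewrite sub0r normrN ler_norm.
Qed.

(** The constant in [bounded_linear] is complex; comparing real parts shows that
    its real part serves equally well. *)
Lemma bounded_linear_rnorm V (W : normedModType R[i]) (L : {linear V -> W}) :
  bounded_linear L ->
  exists2 M : R, 0 <= M & forall f, rnorm (L f) <= M * rnorm f.
Proof.
move=> [M LM]; exists `|complex.Re M| => // f.
apply: (@le_trans _ _ (complex.Re M * rnorm f)).
  have := LM f; rewrite !rnormE lecE => /andP[_] /le_trans; apply.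
  by case: (M) => a b /=; rewrite mulr0 subr0.
by rewrite ler_wpM2r ?rnorm_ge0// ler_norm.
Qed.

Lemma continuous_linear_rnorm V (W : normedModType R[i]) (L : {linear V -> W}) :
  continuous L -> exists2 M : R, 0 <= M & forall f, rnorm (L f) <= M * rnorm f.
Proof.
move=> Lc; apply: bounded_linear_rnorm.
have /linear_boundedP := @continuous_linear_bounded _ _ _ 0 L (Lc 0).
by move=> /pinfty_ex_gt0 [M _ LM]; exists M.
Qed.

Lemma rnorm_bounded_linear V (W : normedModType R[i]) (L : {linear V -> W}) M :
  (forall f, rnorm (L f) <= M * rnorm f) -> bounded_linear L.
Proof.
by move=> LM; exists M%:C%C => f; rewrite !rnormE -rmorphM/= lecR.
Qed.

Lemma bounded_linear_cont V (W : normedModType R[i])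
  (L : {linear V -> W}) : bounded_linear L -> continuous L.
Proof.
move=> /bounded_linear_rnorm[M M0 LM]; apply/linear_bounded_continuous.
apply/linear_boundedP; near=> r => x.
have rM : M%:C%C <= r by near: r; apply: nbhs_pinfty_ge;
  rewrite ger0_real// ler0c.
rewrite (@le_trans _ _ (M%:C%C * `|x|))// ?ler_wpM2r//.
by rewrite !rnormE -rmorphM/= lecR.
Unshelve. all: by end_near. Qed.

End real_norm.
(** * Exponential series in normed modules *)
Section exponential_sums.
Context {R : realType}.
Local Notation C := (Cplx R).
Implicit Types (V : normedModType R[i]) (u v : C) (M K : R).

(** Partial sums of the exponential generating function of x at 1: the powers of
    the variable are part of x. *)
Definition egf {V} (x : nat -> V) (N : nat) : V :=
  \sum_(0 <= k < N) (k`!%:R^-1 : R[i]) *: x k.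

(** The remainder of the real exponential series bounds that of every
    exponential series whose terms grow at most geometrically. *)
Definition exptail (M : R) (N : nat) : R := expR M - series (exp_coeff M) N.

Lemma expRser M : series (exp_coeff M) @ \oo --> expR M.
Proof. exact: is_cvg_series_exp_coeff. Qed.

Lemma cvg_exptail M : exptail M @ \oo --> (0 : R).
Proof.
rewrite -[0](subrr (expR M)); apply: cvgB; [exact: cvg_cst|exact: expRser].
Qed.

Lemma exptail_sum M m n : 0 <= M -> (m <= n)%N ->
  \sum_(m <= k < n) exp_coeff M k <= exptail M m.
Proof.
move=> M0 mn; rewrite /exptail lerBrDl.
have -> : series (exp_coeff M) m + \sum_(m <= k < n) exp_coeff M k =
          series (exp_coeff M) n by rewrite /series/= -big_cat_nat.
apply: nondecreasing_cvgn_le; last exact: is_cvg_series_exp_coeff.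
by apply/nondecreasing_seqP => k; rewrite /series/= big_nat_recr//= lerDl exp_coeff_ge0.
Qed.

Lemma exptail0 M : exptail M 0 = expR M.
Proof. by rewrite /exptail /series/= big_geq// subr0. Qed.

Lemma exptail2 M : 0 <= M -> exptail M 2 <= M ^+ 2 * expR M.
Proof.
move=> M0; rewrite /exptail lerBlDl.
rewrite {1}/expR; apply: limr_le.
  exact: is_cvg_series_exp_coeff.
exists 2%N => // n /= n2.
have -> : series (exp_coeff M) n = series (exp_coeff M) 2 +
    \sum_(2 <= k < n) exp_coeff M k by rewrite /series/= -big_cat_nat.
rewrite lerD2l -(subnK n2) -{1}[2%N]add0n big_addn addnK.
apply: (@le_trans _ _ (M ^+ 2 * \sum_(0 <= k < n - 2) exp_coeff M k)).
  rewrite mulr_sumr; apply: ler_sum => k _; rewrite /exp_coeff/= exprD mulrA.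
  rewrite [M ^+ 2 * _]mulrC ler_wpM2l ?mulr_ge0 ?exprn_ge0//.
  rewrite lef_pV2 ?posrE ?ltr0n ?fact_gt0//.
  by rewrite ler_nat leq_fact ?leq_addr.
rewrite ler_wpM2l ?exprn_ge0//.
by have := exptail_sum M0 (leq0n (n - 2)); rewrite exptail0.
Qed.

Lemma egfD V (x : nat -> V) m n : (m <= n)%N ->
  egf x n - egf x m = \sum_(m <= k < n) (k`!%:R^-1 : R[i]) *: x k.
Proof.
by move=> mn; rewrite /egf (big_cat_nat (n := m))//= addrAC subrr add0r.
Qed.

Lemma rnorm_egfB V (x : nat -> V) K M : 0 <= M ->
  (forall k, rnorm (x k) <= K * M ^+ k) ->
  forall m n, (m <= n)%N -> rnorm (egf x n - egf x m) <= K * exptail M m.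
Proof.
move=> M0 xM m n mn; rewrite egfD//.
have K0 : 0 <= K.
  by have := xM 0%N; rewrite expr0 mulr1; apply: le_trans; rewrite rnorm_ge0.
apply: (le_trans (ler_rnorm_sum _ _ _)).
apply: le_trans (ler_wpM2l K0 (exptail_sum M0 mn)); rewrite mulr_sumr.
apply: ler_sum => k _; rewrite rnormZ rnormV rnorm_nat /exp_coeff/=.
by rewrite [X in _ <= X]mulrA mulrC ler_wpM2r ?invr_ge0.
Qed.

Lemma egf_lim_le V (x : nat -> V) (g : V) K M : 0 <= M ->
  (forall k, rnorm (x k) <= K * M ^+ k) -> egf x @ \oo --> g ->
  forall m, rnorm (g - egf x m) <= K * exptail M m.
Proof.
move=> M0 xM /cvg_rnormP xg m; apply/ler_addgt0Pr => e e0.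
have [N _ xN] := xg _ e0.
apply: (le_trans (ler_rdistD (egf x (maxn m N)) _ _)); rewrite addrC lerD//.
  by apply: rnorm_egfB => //; rewrite leq_maxl.
by apply: xN; rewrite /= leq_maxr.
Qed.

Lemma egf_lim_ex (V : completeNormedModType R[i]) (x : nat -> V) K M : 0 <= M ->
  (forall k, rnorm (x k) <= K * M ^+ k) -> exists g : V, egf x @ \oo --> g.
Proof.
move=> M0 xM; apply: (@cauchy_cvg_tail _ _ _ (fun m => K * exptail M m)).
  by rewrite -[0](mulr0 K); apply: cvgM; [exact: cvg_cst|exact: cvg_exptail].
exact: rnorm_egfB.
Qed.

Lemma egf_linear V (W : normedModType R[i]) (L : {linear V -> W}) (x : nat -> V)
    (g : V) : continuous L ->
  egf x @ \oo --> g -> egf (L \o x) @ \oo --> L g.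
Proof.
move=> Lc xg.
have -> : egf (L \o x) = L \o egf x.
    apply/funext => N; rewrite /egf/= linear_sum.
  by apply: eq_bigr => k _; exact/esym/linearZ_LR.
by apply: continuous_cvg => //; apply: Lc.
Qed.

End exponential_sums.
(** * The complex exponential *)

(** The Cauchy product of two exponential series: the terms of total degree
    at least N are what the product of the N-th partial sums has in excess. *)

Lemma exp_cauchy_product (F : numFieldType) (x y : F) N :
  (\sum_(0 <= k < N) x ^+ k / k`!%:R) * (\sum_(0 <= k < N) y ^+ k / k`!%:R) =
  \sum_(0 <= k < N) (x + y) ^+ k / k`!%:R +
  \sum_(0 <= i < N) \sum_(N - i <= j < N)
     (x ^+ i / i`!%:R) * (y ^+ j / j`!%:R).
Proof.
pose g i j := (x ^+ i / i`!%:R) * (y ^+ j / j`!%:R).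
have binom k : (x + y) ^+ k / k`!%:R = \sum_(0 <= i < k.+1) g i (k - i)%N.
  rewrite addrC exprDn mulr_suml big_mkord; apply: eq_bigr => i _; rewrite /g.
  have ik : (i <= k)%N by rewrite -ltnS.
  rewrite -mulr_natr -[in X in _ / X](bin_fact ik) !natrM.
  have f0 m : m`!%:R != 0 :> F by rewrite pnatr_eq0 -lt0n fact_gt0.
  have b0 : 'C(k, i)%:R != 0 :> F by rewrite pnatr_eq0 -lt0n bin_gt0.
  by field; rewrite !f0 b0.
have triangle M : \sum_(0 <= k < M) \sum_(0 <= i < k.+1) g i (k - i)%N =
    \sum_(0 <= i < M) \sum_(0 <= j < M - i) g i j.
  elim: M => [|M IH]; first by rewrite !big_geq.
  rewrite [LHS]big_nat_recr//= IH [in LHS]big_nat_recr//= addrA -big_split/=.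
  rewrite [RHS]big_nat_recr//= subSnn subnn big_nat1; congr (_ + _).
  apply: eq_big_nat => i /andP[_ iM]; rewrite subSn; last exact: ltnW.
  by rewrite big_nat_recr.
rewrite (eq_bigr _ (fun k _ => binom k)) triangle -big_split/= mulr_suml.
apply: eq_big_nat => i /andP[_ iN]; rewrite mulr_sumr -big_cat_nat//.
exact: leq_subr.
Qed.

Section complex_exponential.
Context {R : realType}.
Local Notation C := (Cplx R).
Implicit Types (u v : C) (M K : R).

Definition cpow u : nat -> C := fun k => u ^+ k.

Lemma rnorm_cpow u k : rnorm (cpow u k) <= 1 * rnorm u ^+ k.
Proof. by rewrite mul1r /cpow rnormX. Qed.

Lemma egf_cpowE u N : egf (cpow u) N = \sum_(0 <= k < N) u ^+ k / k`!%:R.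
Proof. by apply: eq_bigr => k _; rewrite /GRing.scale/= mulrC. Qed.

Lemma rnorm_le_ReIm u : rnorm u <= `|complex.Re u| + `|complex.Im u|.
Proof.
case: u => a b /=.
have -> : Complex a b = a%:C%C + 'i%C * b%:C%C :> C.
  by rewrite [LHS]complexE.
rewrite (le_trans (ler_rnormD _ _))// (rnormM 'i%C) !rnorm_real lerD2l.
suff -> : rnorm ('i%C : C) = 1 by rewrite mul1r.
by rewrite /rnorm/= expr0n/= expr1n add0r sqrtr1.
Qed.

Lemma egf_cpow_real (x : R) :
  egf (cpow (x%:C%C : C)) @ \oo --> ((expR x)%:C%C : C).
Proof.
have -> : egf (cpow (x%:C%C : C)) = (fun N => (series (exp_coeff x) N)%:C%C : C).
  apply/funext => N; rewrite egf_cpowE /series/= rmorph_sum/=.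
  by apply: eq_bigr => k _; rewrite fmorph_div/= rmorphXn/= rmorph_nat.
apply/cvg_rnormP => e e0.
have /cvgrPdist_le /(_ _ e0) := @expRser R x.
by apply: filterS => N; rewrite -rmorphB/= rnorm_real.
Qed.

Lemma imag_exprE (y : R) k : Complex 0 y ^+ k =
  Complex ((~~ odd k)%:R * (-1) ^+ k./2 * y ^+ k)
          ((odd k)%:R * (-1) ^+ k.-1./2 * y ^+ k) :> R[i].
Proof.
elim: k => [|k IH]; first by rewrite !expr0 /= !mul1r !mul0r.
rewrite exprS IH; case: k {IH} => [|k]; simpc.
  by rewrite expr1.
rewrite !exprS /= !negbK uphalf_half; case: (odd k) => /=.
 all: apply/eqP; rewrite eq_complex /=.
 all: apply/andP; split; apply/eqP; rewrite ?exprS; ring.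
Qed.

Lemma egf_cpow_imag (y : R) :
  egf (cpow (Complex 0 y : C)) @ \oo --> (Complex (cos y) (sin y) : C).
Proof.
have -> : egf (cpow (Complex 0 y : C)) =
    (fun N => Complex (series (cos_coeff y) N) (series (sin_coeff y) N) : C).
  apply/funext => N; rewrite egf_cpowE /series/=.
  elim: N => [|N IH]; first by rewrite !big_geq.
  rewrite !big_nat_recr//= IH imag_exprE /cos_coeff /sin_coeff/=.
  rewrite -(rmorph_nat (real_complex R)) -fmorphV/=; simpc.
  by [].
apply/cvg_rnormP => e e0.
have e20 : 0 < e / 2 by rewrite divr_gt0.
have /cvgrPdist_le /(_ _ e20) := @is_cvg_series_cos_coeff R y.
have /cvgrPdist_le /(_ _ e20) := @is_cvg_series_sin_coeff R y.
apply: filterS2 => N; rewrite cos.unlock sin.unlock => sN cN.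
by rewrite (le_trans (rnorm_le_ReIm _))//= (splitr e) lerD.
Qed.

(** By [exp_cauchy_product] the defect between the product of the partial sums
    for u and v and the partial sum for u + v is a sum of monomials in u and v
    with positive coefficients, so it is dominated by the same defect for |u|
    and |v|, which vanishes in the limit since expR is additive. *)
Lemma egf_cpowD u v (a b : C) :
  egf (cpow u) @ \oo --> a -> egf (cpow v) @ \oo --> b ->
  egf (cpow (u + v)) @ \oo --> (a * b : C).
Proof.
move=> ua vb.
pose x := rnorm u; pose y := rnorm v.
pose d N := series (exp_coeff x) N * series (exp_coeff y) N
            - series (exp_coeff (x + y)) N.
have dN N : rnorm (egf (cpow u) N * egf (cpow v) N - egf (cpow (u + v)) N : C)
    <= d N.
  rewrite /d /series/= !egf_cpowE /exp_coeff/= !exp_cauchy_product.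
  have addrBK (V : zmodType) (p q : V) : p + q - p = q by rewrite addrC addKr.
  rewrite !addrBK.
  apply: (le_trans (ler_rnorm_sum _ _ _)); apply: ler_sum => i _.
  apply: (le_trans (ler_rnorm_sum _ _ _)); apply: ler_sum => j _.
  by rewrite !rnormM !rnormV !rnorm_nat !rnormX.
have d0 : d @ \oo --> (0 : R).
  rewrite -(subrr (expR (x + y))) {1}expRD.
  by apply: cvgB; [apply: cvgM|]; exact: expRser.
have ua' := egf_lim_le (rnorm_ge0 u) (rnorm_cpow u) ua.
have vb' := egf_lim_le (rnorm_ge0 v) (rnorm_cpow v) vb.
apply: (@cvg_rnorm_squeeze _ _ _ _ (fun N => (rnorm a * exptail y N +
    exptail x N * (rnorm b + exptail y N)) + d N)) => [N|].
  rewrite (le_trans (ler_rdistD (egf (cpow u) N * egf (cpow v) N : C) _ _))//.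
  rewrite lerD ?dN//.
  have -> : a * b - egf (cpow u) N * egf (cpow v) N =
      a * (b - egf (cpow v) N) + (a - egf (cpow u) N) * egf (cpow v) N :> R[i].
    by rewrite mulrBr mulrBl addrA subrK.
  rewrite (le_trans (ler_rnormD _ _))// lerD// rnormM.
    by rewrite ler_wpM2l ?rnorm_ge0// -[leRHS]mul1r vb'.
  apply: ler_pM; rewrite ?rnorm_ge0//; first by rewrite -[leRHS]mul1r ua'.
  have -> : egf (cpow v) N = b - (b - egf (cpow v) N) by rewrite subKr.
  by rewrite (le_trans (ler_rnormB _ _))// lerD2l -[leRHS]mul1r vb'.
have -> : (0 : R) = (rnorm a * 0 + 0 * (rnorm b + 0)) + 0 by ring.
apply: cvgD d0; apply: cvgD; apply: cvgM; try exact: cvg_exptail.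
  exact: cvg_cst.
by apply: cvgD; [exact: cvg_cst|exact: cvg_exptail].
Qed.

Lemma egf_cpow u : egf (cpow u) @ \oo --> cexp u.
Proof.
have -> : cexp u = ((expR (complex.Re u))%:C%C : C) *
                   Complex (cos (complex.Im u)) (sin (complex.Im u)).
  by rewrite /cexp; simpc.
have {1}-> : u = ((complex.Re u)%:C%C : C) + Complex 0 (complex.Im u).
  by case: u => x y /=; simpc.
by apply: egf_cpowD; [exact: egf_cpow_real|exact: egf_cpow_imag].
Qed.

Lemma cexpD u v : cexp (u + v) = cexp u * cexp v.
Proof.
apply: (@cvg_unique _ _ (egf (cpow (u + v)) @ \oo)) => //.
  exact: egf_cpow.
by apply: egf_cpowD; exact: egf_cpow.
Qed.

Lemma cexp0 : cexp 0 = 1 :> C.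
Proof. by rewrite /cexp/= expR0 cos0 sin0 mul1r mulr0. Qed.

Lemma cexp_neq0 u : cexp u != 0.
Proof.
apply/negP => /eqP u0; have := cexpD u (- u).
by rewrite subrr cexp0 u0 mul0r => /eqP; rewrite oner_eq0.
Qed.

Lemma cexp_sum I (s : seq I) (P : pred I) (f : I -> C) :
  cexp (\sum_(i <- s | P i) f i) = \prod_(i <- s | P i) cexp (f i).
Proof. exact: (big_morph _ cexpD cexp0). Qed.

Lemma rnorm_cexp_sub1D u :
  rnorm (cexp u - 1 - u) <= rnorm u ^+ 2 * expR (rnorm u).
Proof.
have := egf_lim_le (rnorm_ge0 u) (rnorm_cpow u) (@egf_cpow u) 2.
have -> : egf (cpow u) 2 = 1 + u.
  by rewrite egf_cpowE big_nat_recr//= big_nat1 expr0 expr1 !divr1.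
rewrite mul1r opprD addrA => /le_trans; apply.
exact/exptail2/rnorm_ge0.
Qed.

End complex_exponential.
(** * Counting the zeros of polynomials *)
Section zeros.
Context {R : realType}.
Local Notation C := (Cplx R).
Implicit Types (P Q : {poly R[i]}) (r K M B : R) (s : seq R[i]).

(** Values of polynomials over R[i] live in the ring R[i], and have to be seen
    in its regular module to have a norm. *)
Definition cnorm (z : R[i]) : R := rnorm (z : C).

Lemma horner_even_poly Q t : (Q.[t] + Q.[- t]) = (even_poly Q).[t ^+ 2] *+ 2.
Proof.
have E x : Q.[x] = (even_poly Q).[x ^+ 2] + (odd_poly Q).[x ^+ 2] * x.
  by rewrite -{1}(poly_even_odd Q) hornerD hornerM !horner_comp hornerXn hornerX.
by rewrite !E sqrrN mulrN addrACA subrr addr0 mulr2n.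
Qed.

(** The maximum principle at the centre of a disc. Averaging Q over t and - t
    leaves the even part of Q, which is a polynomial of about half the size in
    t ^+ 2, where t ^+ 2 runs over the circle of radius r ^+ 2; iteration ends
    at the constant Q.[0]. *)
Lemma rnorm_horner0 Q r B : 0 <= r ->
  (forall t, cnorm t = r -> cnorm Q.[t] <= B) -> cnorm Q.[0] <= B.
Proof.
have [n] := ubnP (size Q); elim: n Q r => // n IH Q r; rewrite ltnS => Qn r0 QB.
have [Q1|Q1] := leqP (size Q) 1.
  have /QB : cnorm r%:C%C = r by rewrite /cnorm rnorm_real ger0_norm.
  by rewrite (size1_polyC Q1) !hornerC.
have <- : (even_poly Q).[0] = Q.[0].
  have /eqP := horner_even_poly Q 0.
  by rewrite oppr0 expr0n/= -mulr2n eqr_pMn2r// => /eqP.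
apply: (IH _ (r ^+ 2)); rewrite ?exprn_ge0//.
  rewrite (leq_ltn_trans (size_even_poly _))// (leq_trans _ Qn)//.
  by case: (size Q) Q1 => [|[|m]]//= _;
  rewrite !ltnS leq_uphalf_double -addnn leq_addr.
move=> t tr; have tE := sqr_sqrtc t.
have sr : cnorm (sqrtc t) = r.
  apply/eqP; rewrite -(eqrXn2 (n := 2))// ?rnorm_ge0//.
  by rewrite -tr -{2}tE /cnorm (@rnormX R).
have := horner_even_poly Q (sqrtc t); rewrite tE => QE.
have : cnorm ((even_poly Q).[t] *+ 2) <= B *+ 2.
  rewrite -QE mulr2n (le_trans (ler_rnormD _ _))// lerD// QB//.
  by rewrite /cnorm rnormN.
by rewrite -mulr_natl /cnorm (@rnormM R) rnorm_nat -(mulr_natl B) ler_pM2l.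
Qed.

(** Polynomials with value 1 at 0, parametrized by the inverses of their
    zeros. *)
Definition zprod s : {poly R[i]} := \prod_(x <- s) (1 - x *: 'X).

Lemma horner_zprod s t : (zprod s).[t] = \prod_(x <- s) (1 - x * t).
Proof. by rewrite horner_prod; apply: eq_bigr => x _; rewrite !hornerE. Qed.

Lemma coef0_zprod s : (zprod s)`_0 = 1.
Proof.
rewrite -horner_coef0 horner_zprod big1// => x _; by rewrite mulr0 subr0.
Qed.

Lemma coef1_zprod s : (zprod s)`_1 = - \sum_(x <- s) x.
Proof.
elim: s => [|x s IH]; first by rewrite /zprod !big_nil coef1 oppr0.
rewrite /zprod !big_cons -/(zprod s) mulrBl mul1r coefB IH -scalerAl coefZ.
by rewrite coefXM/= coef0_zprod mulr1 opprD addrC.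
Qed.

Lemma poly_zprod P : P`_0 != 0 -> exists s, P = P`_0 *: zprod s /\
  forall x, x \in s -> x != 0 /\ root P x^-1.
Proof.
move=> P0; have [zs Pz] := closed_field_poly_normal P.
have lc0 : lead_coef P != 0.
  by rewrite lead_coef_eq0; apply: contraNneq P0 => ->; rewrite coef0.
have rz z : z \in zs -> root P z.
  by move=> zin; rewrite Pz rootZ// root_prod_XsubC.
have z0 z : z \in zs -> z != 0.
  move=> /rz; apply: contraTneq => ->.
  by rewrite /root horner_coef0.
exists [seq z^-1 | z <- zs]; split; last first.
  move=> x /mapP[z zin ->]; rewrite invr_eq0 invrK; split; [exact: z0|exact: rz].
have PE : P = (lead_coef P * \prod_(z <- zs) - z) *: zprod [seq z^-1 | z <- zs].
  rewrite {1}Pz -scalerA; congr (_ *: _).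
  rewrite /zprod big_map -scaler_prod; apply: eq_big_seq => z zin.
  by rewrite scalerBr scalerA mulNr mulfV ?z0// scaleN1r opprK addrC scaleNr alg_polyC.
rewrite {1}PE; congr (_ *: _).
by rewrite [in RHS]PE coefZ coef0_zprod mulr1.
Qed.

(** On the circle of radius 3r the factor of a zero of modulus at most r has
    modulus at least 2; the cofactor is controlled at 0 by its values on that
    circle. *)
Lemma zprod_count (a : R[i]) s r K : 0 < r ->
  (forall t, cnorm t = 3 * r -> cnorm (a *: zprod s).[t] <= K) ->
  cnorm a * 2 ^+ count (fun x => 1 <= r * cnorm x) s <= K.
Proof.
move=> r0 PK; set p := fun x => _.
pose Q := a *: \prod_(x <- s | ~~ p x) (1 - x *: 'X).
have Q0 : Q.[0] = a.
  rewrite hornerZ horner_prod big1 ?mulr1// => x _.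
  by rewrite !hornerE ?mulr0 ?subr0.
rewrite -{1}Q0 -ler_pdivlMr ?exprn_gt0//.
apply: (@rnorm_horner0 _ (3 * r)) => [|t tr]; first by rewrite mulr_ge0 ?ltW.
rewrite ler_pdivlMr ?exprn_gt0//; apply: le_trans (PK _ tr).
have -> : (a *: zprod s).[t] =
    Q.[t] * \prod_(x <- s | p x) (1 - x * t).
  rewrite /Q !hornerZ horner_zprod horner_prod (bigID p)/= -mulrA [X in _ * X]mulrC.
  by congr (_ * (_ * _)); apply: eq_bigr => x _; rewrite !hornerE.
rewrite /cnorm (@rnormM R) ler_wpM2l ?rnorm_ge0// (@rnorm_prod R).
elim: (s) => [|x s' IH]; first by rewrite big_nil.
rewrite big_cons/=; case: ifPn => px; last by rewrite add0n.
rewrite exprS ler_pM// ?exprn_ge0//.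
have h : 3 <= cnorm (x * t).
  rewrite /cnorm (@rnormM R) -/(cnorm t) tr mulrCA -[leLHS]mulr1 ler_wpM2l//.
  by rewrite mulrC.
have := ler_rdistD (1 : C) (x * t : C) 0; move: h; rewrite /cnorm.
rewrite !subr0 rnorm1 (rdistC (x * t : C)).
move=> h1 /(le_trans h1); rewrite -lerBlDr; apply: le_trans; lra.
Qed.

(** Both bounds on the i-th term combine to (i + 1 + q) y_i <= 2 c, so that
    y_i^2 <= 4 c^2 / ((i + q) (i + 1 + q)), a telescoping bound. *)
Lemma sorted_sum_sqr (y : seq R) (c q : R) : 0 < c -> 0 < q ->
  (forall i, (i < size y)%N ->
     [/\ 0 <= y`_i, y`_i * i.+1%:R <= c & y`_i * q <= c]) ->
  \sum_(x <- y) x ^+ 2 <= 4 * c ^+ 2 / q.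
Proof.
move=> c0 q0 yi; rewrite (big_nth 0).
pose f i := - (4 * c ^+ 2 / (i%:R + q)) : R.
apply: (@le_trans _ _ (\sum_(0 <= i < size y) (f i.+1 - f i))).
  rewrite !big_nat; apply: ler_sum => i /andP[_ /yi[y0 yc yq]].
  have i0 : 0 <= i%:R :> R by [].
  have iq0 : 0 < i%:R + q by rewrite ltr_wpDl.
  have i1q0 : 0 < i.+1%:R + q by rewrite ltr_wpDl.
  rewrite /f opprK addrC.
  have -> : 4 * c ^+ 2 / (i%:R + q) - 4 * c ^+ 2 / (i.+1%:R + q) =
      (4 * c ^+ 2) / ((i%:R + q) * (i.+1%:R + q)).
    move: i1q0; rewrite -natr1 [_ + 1 + q]addrAC; move: (_ + q) iq0 => w w0 w10.
    by field; rewrite !gt_eqF.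
  rewrite ler_pdivlMr ?mulr_gt0//.
  have h : y`_i * (i.+1%:R + q) <= 2 * c by lra.
  have h0 : 0 <= y`_i * (i.+1%:R + q) by rewrite mulr_ge0// ltW.
  apply: (@le_trans _ _ ((y`_i * (i.+1%:R + q)) ^+ 2)).
    rewrite exprMn ler_wpM2l ?exprn_ge0// expr2 ler_wpM2r ?(ltW i1q0)//.
    by rewrite lerD2r ler_nat.
  have -> : 4 * c ^+ 2 = (2 * c) ^+ 2 by rewrite exprMn; congr (_ * _); ring.
  by rewrite lerXn2r// ?nnegrE// mulr_ge0// ltW.
rewrite telescope_sumr// /f add0r opprK gerDr oppr_le0.
by rewrite divr_ge0 ?mulr_ge0 ?exprn_ge0// ?addr_ge0// ltW.
Qed.

(** When the terms are sorted in decreasing order, the i-th one is at most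
    c / (i + 1) by the hypothesis on the counting function, and at most sg:
    this is [sorted_sum_sqr] with q = c / sg. *)
Lemma sum_sqr_count (y : seq R) (c sg : R) : 0 < c -> 0 < sg ->
  (forall x, x \in y -> 0 <= x <= sg) ->
  (forall x, x \in y -> x * (count (>= x) y)%:R <= c) ->
  \sum_(x <- y) x ^+ 2 <= 4 * c * sg.
Proof.
move=> c0 s0 ys yc; rewrite -(perm_big _ (permEl (perm_sort >=%R y)))/=.
have -> : 4 * c * sg = 4 * c ^+ 2 / (c / sg) by field; rewrite !gt_eqF.
apply: sorted_sum_sqr => //; first exact: divr_gt0.
set z := sort _ y => i iz.
have zy x : (x \in z) = (x \in y) by rewrite mem_sort.
have iy : z`_i \in y by rewrite -zy mem_nth.
have /andP[zi0 zis] := ys _ iy; split => //; last first.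
  by rewrite mulrA ler_pdivrMr// mulrC ler_wpM2l// ltW.
apply: le_trans (yc _ iy); rewrite ler_wpM2l// ler_nat.
have -> : count (>= z`_i) y = count (>= z`_i) z.
  by apply/permP; rewrite perm_sym perm_sort.
rewrite -(cat_take_drop i.+1 z) count_cat.
suff -> : count (>= (take i.+1 z ++ drop i.+1 z)`_i) (take i.+1 z) = i.+1.
  exact: leq_addr.
rewrite cat_take_drop -[RHS](size_takel iz); apply/eqP; rewrite -all_count.
apply/(all_nthP 0) => j; rewrite (size_takel iz) ltnS => ji.
rewrite nth_take//=.
apply: (sorted_leq_nth (leT := >=%R)) => //.
- by move=> a b d ab bd; apply: le_trans bd ab.
- by move=> a; exact: lexx.
- by apply: sort_sorted => a b; exact: le_total.
- by rewrite inE (leq_ltn_trans ji).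
Qed.

End zeros.
(** * Entire functions of exponential type without zeros *)
Section hadamard.
Context {R : realType}.
Local Notation C := (Cplx R).

(** The linear terms of 1 - u and e^u cancel: (1 - u) e^u is the elementary
    factor of genus one. *)
Lemma rnorm_weierstrass (u : C) : rnorm u <= 1 ->
  rnorm ((1 - u) * cexp u - 1 : C) <= (1 + 2 * expR 1) * rnorm u ^+ 2.
Proof.
move=> u1; have u0 := rnorm_ge0 u.
have -> : (1 - u) * cexp u - 1 =
    (1 - u) * (cexp u - 1 - u) - u ^+ 2 :> R[i] by ring.
rewrite (le_trans (ler_rnormB _ _))// [leLHS]addrC rnormX.
rewrite [leRHS]mulrDl mul1r lerD2l rnormM.
rewrite -mulrA ler_pM ?rnorm_ge0//.
  by rewrite (le_trans (ler_rnormB _ _))// rnorm1; lra.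
rewrite (le_trans (rnorm_cexp_sub1D u))// mulrC ler_wpM2r ?exprn_ge0//.
by rewrite ler_expR.
Qed.

Lemma rnorm_prod_sub1 (s : seq C) (f : C -> C) (g : C -> R) :
  (forall x, x \in s -> rnorm (f x - 1) <= g x) ->
  rnorm (\prod_(x <- s) f x - 1 : C) <= expR (\sum_(x <- s) g x) - 1.
Proof.
elim: s => [|x s IH] fg; first by rewrite !big_nil expR0 !subrr rnorm0.
have {}IH := IH (fun y ys => fg y (mem_behead (s := x :: s) ys)).
have {}fg := fg x (mem_head x s).
rewrite !big_cons expRD; set p := \prod_(_ <- _) _ in IH *.
set e := expR (\sum_(_ <- _) _) in IH *.
have -> : f x * p - 1 = (f x - 1) * (p - 1) + (f x - 1) + (p - 1) :> R[i].
  by ring.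
have g0 : 0 <= g x := le_trans (rnorm_ge0 _) fg.
have eg := expR_ge1Dx (g x).
have e0 : 0 <= e := expR_ge0 _.
have := ler_rnormD ((f x - 1) * (p - 1) + (f x - 1) : C) (p - 1).
have := ler_rnormD ((f x - 1) * (p - 1) : C) (f x - 1).
rewrite rnormM => h1 h2.
have h3 := ler_pM (rnorm_ge0 _) (rnorm_ge0 _) fg IH.
have h4 : g x * e <= (expR (g x) - 1) * e by rewrite ler_wpM2r//; lra.
by lra.
Qed.

Lemma rnorm_subX (t t' : C) r k : rnorm t <= r -> rnorm t' <= r ->
  rnorm (t ^+ k - t' ^+ k : C) <= rnorm (t - t') * (r + 1) ^+ k.
Proof.
move=> tr t'r; have r0 : 0 <= r := le_trans (rnorm_ge0 _) tr.
elim: k => [|k IH]; first by rewrite !expr0 subrr rnorm0 mulr1 rnorm_ge0.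
have -> : t ^+ k.+1 - t' ^+ k.+1 =
    t * (t ^+ k - t' ^+ k) + (t - t') * t' ^+ k :> R[i] by rewrite !exprS; ring.
rewrite (le_trans (ler_rnormD _ _))// !rnormM exprS mulrDl mulrDr lerD//.
  by rewrite mulrCA ler_pM ?rnorm_ge0.
rewrite mul1r ler_wpM2l ?rnorm_ge0// rnormX lerXn2r ?nnegrE ?rnorm_ge0 ?addr_ge0//.
by lra.
Qed.

Lemma rnorm_ge_ReIm (u : C) :
  `|complex.Re u| <= rnorm u /\ `|complex.Im u| <= rnorm u.
Proof.
case: u => a b; rewrite /rnorm/= -!sqrtr_sqr.
by split; apply: ler_wsqrtr; rewrite ?lerDl ?lerDr sqr_ge0.
Qed.

Section exponential_type.
Variables (lam : nat -> C) (F : C -> C) (K M : R).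
Hypothesis M0 : 0 <= M.
Hypothesis lamM : forall k, rnorm (lam k) <= K * M ^+ k.
Hypothesis FE : forall t, egf (fun k => lam k * t ^+ k : C) @ \oo --> F t.

Let K0 : 0 <= K.
Proof. by have := lamM 0; rewrite expr0 mulr1; apply: le_trans; exact: rnorm_ge0. Qed.

Let rnorm_term (t : C) r k : rnorm t <= r ->
  rnorm (lam k * t ^+ k : C) <= K * (M * r) ^+ k.
Proof.
move=> tr; rewrite rnormM rnormX exprMn mulrA.
rewrite ler_pM ?rnorm_ge0 ?exprn_ge0 ?rnorm_ge0//.
by rewrite lerXn2r ?nnegrE ?rnorm_ge0// (le_trans (rnorm_ge0 t)).
Qed.

Lemma rnorm_egf_tail (t : C) r N : rnorm t <= r ->
  rnorm (F t - egf (fun k => lam k * t ^+ k : C) N) <= K * exptail (M * r) N.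
Proof.
move=> tr; have Mr0 : 0 <= M * r by rewrite mulr_ge0// (le_trans (rnorm_ge0 t)).
by apply: egf_lim_le Mr0 _ (@FE t) N => k; apply: rnorm_term.
Qed.

Lemma egf_lipschitz t t' r : rnorm t <= r -> rnorm t' <= r ->
  rnorm (F t - F t') <= K * expR (M * (r + 1)) * rnorm (t - t').
Proof.
move=> tr t'r; have r0 : 0 <= r := le_trans (rnorm_ge0 _) tr.
have FtE : egf (fun k => lam k * (t ^+ k - t' ^+ k) : C) @ \oo --> F t - F t'.
  have -> : egf (fun k => lam k * (t ^+ k - t' ^+ k) : C) =
      (fun N => egf (fun k => lam k * t ^+ k : C) N -
                egf (fun k => lam k * t' ^+ k : C) N).
    apply/funext => N; rewrite /egf -sumrB; apply: eq_bigr => k _.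
    by rewrite mulrBr scalerBr.
  by apply: cvgB; exact: FE.
have bd k : rnorm (lam k * (t ^+ k - t' ^+ k) : C) <=
    (K * rnorm (t - t')) * (M * (r + 1)) ^+ k.
  rewrite rnormM exprMn mulrACA ler_pM ?rnorm_ge0//; exact: rnorm_subX.
have m0 : 0 <= M * (r + 1) by rewrite mulr_ge0// addr_ge0.
have := egf_lim_le m0 bd FtE 0.
by rewrite /egf big_geq// subr0 exptail0 mulrAC.
Qed.

(** Compactness is used on the square [- r, r] x [- r, r] of the real plane,
    which contains the disc. *)
Lemma egf_min_disc r : 0 <= r -> (forall t, F t != 0) ->
  exists2 d, 0 < d & forall t, rnorm t <= r -> d <= rnorm (F t).
Proof.
move=> r0 F0.
pose f (p : R * R) := rnorm (F (Complex p.1 p.2)).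
have fc : continuous f.
  move=> p; pose q := `|p.1| + `|p.2| + 2.
  pose L := K * expR (M * (q + 1)).
  have L0 : 0 <= L by rewrite mulr_ge0// expR_ge0.
  apply/cvgrPdist_le => e e0.
  pose d := Num.min 1 (e / (2 * (L + 1))).
  have d0 : 0 < d by rewrite lt_min ltr01/= divr_gt0// mulr_gt0// ltr_wpDl.
  have : \forall p' \near p, ball p d p' by exact: nbhsx_ballx.
  apply: filterS => -[x y] [/=]; rewrite /ball/= => dx dy.
  have d1 : d <= 1 by rewrite ge_min lexx.
  have hx : `|x| <= `|p.1| + 1.
    rewrite -[x](subKr p.1) (le_trans (ler_normB _ _))// lerD2l.
    by rewrite (le_trans (ltW dx)).
  have hy : `|y| <= `|p.2| + 1.
    rewrite -[y](subKr p.2) (le_trans (ler_normB _ _))// lerD2l.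
    by rewrite (le_trans (ltW dy)).
  have h1 : rnorm (Complex p.1 p.2 : C) <= q.
    by rewrite (le_trans (rnorm_le_ReIm _))//= /q; lra.
  have h2 : rnorm (Complex x y : C) <= q.
    by rewrite (le_trans (rnorm_le_ReIm _))//= /q; lra.
  have FL := egf_lipschitz h1 h2.
  have h3 : rnorm (Complex p.1 p.2 - Complex x y : C) <= 2 * d.
    by rewrite (le_trans (rnorm_le_ReIm _))//=; lra.
  have h4 : `|f p - f (x, y)| <= rnorm (F (Complex p.1 p.2) - F (Complex x y)).
    rewrite ler_norml /f /=.
    have := ler_rdistD (F (Complex x y)) (F (Complex p.1 p.2)) 0.
    have := ler_rdistD (F (Complex p.1 p.2)) (F (Complex x y)) 0.
    rewrite !subr0 (rdistC (F (Complex x y))) => g1 g2.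
    by apply/andP; split; lra.
  apply: (le_trans h4); apply: (le_trans FL).
  apply: (@le_trans _ _ (L * (2 * d))); first by rewrite ler_wpM2l.
  apply: (@le_trans _ _ ((L + 1) * (2 * d))).
    by rewrite ler_wpM2r ?lerDl// mulr_ge0// ltW.
  have : d <= e / (2 * (L + 1)) by rewrite ge_min lexx orbT.
  rewrite ler_pdivlMr; last by rewrite mulr_gt0// ltr_wpDl.
  by have -> : d * (2 * (L + 1)) = (L + 1) * (2 * d) by ring.
pose A := `[- r, r]%classic `*` `[- r, r]%classic : set (R * R).
have A0 : A !=set0.
  by exists (0, 0); split; rewrite /= in_itv/= oppr_le0 r0.
have cA : compact A by apply: compact_setX; exact: segment_compact.
have [c _ cmin] := compact_EVT_min A0 cA (continuous_subspaceT fc).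
exists (f c) => [|t tr]; first by rewrite rnorm_gt0.
have -> : rnorm (F t) = f (complex.Re t, complex.Im t) by rewrite /f; case: t {tr}.
have [tRe tIm] := rnorm_ge_ReIm t.
apply: cmin; rewrite inE; split; rewrite /= in_itv/= -ler_norml.
  exact: le_trans tr.
exact: le_trans tr.
Qed.

Let cvg_tail r e : 0 < e ->
  exists N0, forall N, (N0 <= N)%N -> K * exptail (M * r) N <= e.
Proof.
move=> e0; have : (fun N => K * exptail (M * r) N) @ \oo --> (0 : R).
  by rewrite -(mulr0 K); apply: cvgM; [exact: cvg_cst|exact: cvg_exptail].
move=> /cvgrPdist_le /(_ _ e0) [N0 _ NE]; exists N0 => N /NE.
by rewrite sub0r normrN; apply: le_trans; exact: ler_norm.
Qed.

Hypothesis F0 : forall t, F t != 0.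

Let a := lam 0.

Let F0E : F 0 = a.
Proof.
apply: subr0_eq; apply/eqP; rewrite -rnorm_eq0; apply/eqP/le_anti.
rewrite rnorm_ge0 andbT.
have := @rnorm_egf_tail 0 0 1; rewrite rnorm0 mulr0 => /(_ (lexx _)).
rewrite /egf big_nat1 expr0 mulr1 fact0 invr1 scale1r => /le_trans; apply.
by rewrite /exptail /series/= big_nat1 /exp_coeff/= expr0 expR0 divr1 subrr mulr0.
Qed.

Let a0 : a != 0.
Proof. by rewrite -F0E. Qed.

Let P N : {poly R[i]} := \poly_(k < N) (lam k / k`!%:R).

Let hornerP N t : (P N).[t] = egf (fun k => lam k * t ^+ k : C) N.
Proof.
rewrite horner_poly /egf big_mkord; apply: eq_bigr => k _.
by rewrite mulrAC mulrC.
Qed.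

Let rnormP N t : cnorm (P N).[t] <= K * expR (M * cnorm t).
Proof.
rewrite hornerP /cnorm -exptail0.
have Mt0 : 0 <= M * rnorm (t : C) by rewrite mulr_ge0// rnorm_ge0.
have := @rnorm_egfB _ _ (fun k => lam k * t ^+ k : C) _ _ Mt0
  (fun k => rnorm_term k (lexx _)) 0 N (leq0n N).
by rewrite {2}/egf big_geq// subr0.
Qed.

(** F stays away from 0 on the disc of radius 1 / sg, and the Taylor
    polynomials converge to it uniformly there. *)
Let zeros_near_infinity sg : 0 < sg -> exists N0, forall N, (N0 <= N)%N ->
  forall x, x != 0 -> root (P N) x^-1 -> cnorm x <= sg.
Proof.
move=> s0; have r0 : 0 <= sg^-1 by rewrite invr_ge0 ltW.
have [d d0 dF] := egf_min_disc r0 F0.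
have d20 : 0 < d / 2 by rewrite divr_gt0.
have [N0 NE] := cvg_tail sg^-1 d20.
exists N0 => N /NE tailN x x0 /eqP rx; rewrite leNgt; apply/negP => sgx.
have xr : rnorm (x^-1 : C) <= sg^-1.
  by rewrite rnormV lef_pV2 ?posrE ?ltW// rnorm_gt0.
have := rnorm_egf_tail N xr; rewrite -hornerP rx subr0.
by have := dF _ xr; move: tailN; lra.
Qed.

Let c := (ln (K / rnorm a) + 3 * M + 1) / ln 2.

Let ln2_gt0 : 0 < ln 2 :> R.
Proof. by rewrite ln_gt0// ltr1n. Qed.

Let ra0 : 0 < rnorm a.
Proof. by rewrite rnorm_gt0. Qed.

Let aK : rnorm a <= K.
Proof. by have := lamM 0; rewrite expr0 mulr1. Qed.

Let lnKa_ge0 : 0 <= ln (K / rnorm a).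
Proof. by rewrite ln_ge0// ler_pdivlMr// mul1r. Qed.

Let c0 : 0 < c.
Proof. by rewrite divr_gt0// ltr_wpDl// addr_ge0// mulr_ge0. Qed.

Let count_zeros N s r : 1 <= r -> P N = a *: zprod s ->
  (count (fun x => (1 <= r * cnorm x)%R) s)%:R <= c * r.
Proof.
move=> r1 PE; have r0 : 0 < r by apply: lt_le_trans r1.
have /(zprod_count r0) : forall t, cnorm t = 3 * r ->
    cnorm (a *: zprod s).[t] <= K * expR (M * (3 * r)).
  by move=> t tr; rewrite -PE -tr; exact: rnormP.
set k := count _ _ => h; have K1 : 0 < K by apply: lt_le_trans aK.
have : ln (2 ^+ k) <= ln (K / rnorm a * expR (M * (3 * r))).
  rewrite ler_ln ?posrE ?exprn_gt0 ?mulr_gt0 ?invr_gt0 ?expR_gt0//.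
  by rewrite mulrAC ler_pdivlMr// mulrC.
rewrite lnM ?posrE ?divr_gt0 ?expR_gt0// expRK lnXn// => {}h.
rewrite /c mulrAC ler_pdivlMr// [leLHS]mulr_natl (le_trans h)//.
have : ln (K / rnorm a) <= ln (K / rnorm a) * r by rewrite ler_peMr.
by lra.
Qed.

Let sum_sqr_zeros N s sg : 0 < sg <= 1 -> P N = a *: zprod s ->
  (forall x, x \in s -> x != 0 /\ cnorm x <= sg) ->
  \sum_(x <- s) cnorm x ^+ 2 <= 4 * c * sg.
Proof.
move=> /andP[s0 s1] PE sP.
rewrite -(big_map cnorm xpredT (fun y => y ^+ 2)).
apply: sum_sqr_count => // _ /mapP[x /sP[x0 xs] ->].
  by rewrite rnorm_ge0.
have cx : 0 < cnorm x by rewrite rnorm_gt0.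
have r1 : 1 <= (cnorm x)^-1 by rewrite invf_ge1// (le_trans xs).
have := count_zeros r1 PE; rewrite ler_pdivlMr// mulrC.
suff -> : count (fun z => 1 <= (cnorm x)^-1 * cnorm z) s =
    count (>= cnorm x) [seq cnorm z | z <- s] by [].
by rewrite count_map; apply: eq_count => z /=; rewrite ler_pdivlMl// mulr1.
Qed.

(** The coefficients of degree 0 and 1 of P N are those of the series, which
    identifies the sum of the inverse zeros and turns the left-hand side into a
    product of elementary factors. *)
Let rnorm_zprod_exp N s sg (t : C) :
  (1 < N)%N -> 0 < sg <= 1 -> sg * rnorm t <= 1 ->
  P N = a *: zprod s ->
  (forall x, x \in s -> x != 0 /\ cnorm x <= sg) ->
  rnorm ((P N).[t] / a * cexp (- (t * (lam 1 / a))) - 1 : C) <=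
  expR ((1 + 2 * expR 1) * rnorm t ^+ 2 * (4 * c) * sg) - 1.
Proof.
move=> N1 sg01 sgt PE sP.
have lam1 : lam 1 / a = - \sum_(x <- s) x.
  have := congr1 (fun q : {poly R[i]} => q`_1) PE.
  rewrite coefZ coef1_zprod coef_poly N1 (_ : 1`! = 1)%N// divr1 => ->.
  by rewrite mulrC mulKf.
have -> : (P N).[t] / a * cexp (- (t * (lam 1 / a))) =
    \prod_(x <- s) ((1 - x * t) * cexp (x * t)) :> C.
  rewrite PE hornerZ horner_zprod big_split/= -cexp_sum -mulr_suml mulrC.
  rewrite lam1 mulrN opprK [t * _]mulrC mulrC; congr (_ * _).
  by rewrite mulrC mulKf.
apply: (@le_trans _ _ (expR (\sum_(x <- s)
    ((1 + 2 * expR 1) * rnorm t ^+ 2 * cnorm x ^+ 2)) - 1)).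
  apply: rnorm_prod_sub1 => x /sP[x0 xs].
  have xt : rnorm (x * t : C) <= 1.
    by rewrite rnormM (le_trans _ sgt)// ler_wpM2r// rnorm_ge0.
  rewrite (le_trans (rnorm_weierstrass xt))// rnormM exprMn -mulrA.
  by rewrite [in leLHS](mulrC (_ ^+ 2)).
rewrite lerD2r ler_expR -mulr_sumr -[leRHS]mulrA ler_wpM2l ?(sum_sqr_zeros sg01 PE)//.
by rewrite mulr_ge0 ?exprn_ge0 ?rnorm_ge0// addr_ge0// mulr_ge0// expR_ge0.
Qed.

(** Hadamard's factorization theorem for zero-free functions of exponential
    type. *)
Lemma hadamard_exp_type t : F t = a * cexp (t * (lam 1 / a)).
Proof.
pose G := cexp (- (t * (lam 1 / a))) : C.
suff /eqP : F t / a * G - 1 = 0 :> C.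
  rewrite subr_eq0 => /eqP FG.
  have GE : G * cexp (t * (lam 1 / a)) = 1 by rewrite -cexpD addNr cexp0.
  rewrite -[LHS]mulr1 -GE mulrA -[F t](divfK a0) [_ / a * a]mulrC -(mulrA a).
  by rewrite FG mulr1.
apply: rnorm_le_small => e e0.
have e20 : 0 < e / 2 by rewrite divr_gt0.
pose B := (1 + 2 * expR 1) * rnorm t ^+ 2 * (4 * c).
have B0 : 0 <= B.
  have e1 : 0 <= expR 1 :> R := expR_ge0 _.
  apply: mulr_ge0; last by rewrite mulr_ge0// ltW.
  by apply: mulr_ge0; [lra|rewrite exprn_ge0// rnorm_ge0].
(* Inverse zeros s_j of modulus at most sg satisfy |s_j t| <= 1 and keep the
   bound of rnorm_zprod_exp below e / 2. *)
pose sg := Num.min (Num.min 1 (rnorm t + 1)^-1) (ln (1 + e / 2) / (B + 1)).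
have t1 : 0 < rnorm t + 1 by rewrite ltr_wpDl// rnorm_ge0.
have B1 : 0 < B + 1 by rewrite ltr_wpDl.
have l0 : 0 < ln (1 + e / 2) by rewrite ln_gt0// ltrDl.
have sg01 : 0 < sg <= 1.
  by rewrite !lt_min ltr01 invr_gt0 t1 divr_gt0//= ge_min ge_min lexx.
have sg0 : 0 < sg by case/andP: sg01.
have sgt : sg * rnorm t <= 1.
  apply: (@le_trans _ _ (sg * (rnorm t + 1))).
    by rewrite ler_wpM2l ?(ltW sg0)// lerDl.
  by rewrite -ler_pdivlMr// div1r !ge_min lexx orbT.
have sgB : expR (B * sg) - 1 <= e / 2.
  have : B * sg <= ln (1 + e / 2).
    apply: (@le_trans _ _ ((B + 1) * sg)).
      by rewrite ler_wpM2r ?(ltW sg0)// lerDl.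
    by rewrite mulrC -ler_pdivlMr// ge_min lexx orbT.
  by rewrite -ler_expR lnK ?posrE; lra.
have [N1 NE1] := zeros_near_infinity sg0.
(* A bound for the distance from P N to F at t, to be multiplied by |G| / |a|. *)
have gp : 0 < (e / 2) * (rnorm a / (rnorm G + 1)).
  by rewrite mulr_gt0// divr_gt0// ltr_wpDl// rnorm_ge0.
have [N2 NE2] := cvg_tail (rnorm t) gp.
pose N := maxn 2 (maxn N1 N2).
have N_1 : (1 < N)%N by rewrite leq_maxl.
have N_2 : (N1 <= N)%N by rewrite !leq_max leqnn orbT.
have N_3 : (N2 <= N)%N by rewrite !leq_max leqnn !orbT.
have P0 : (P N)`_0 = a by rewrite coef_poly (ltn_trans _ N_1)// fact0 divr1.
have [|s [PE sP]] := @poly_zprod _ (P N); first by rewrite P0.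
rewrite P0 in PE.
have sP' x : x \in s -> x != 0 /\ cnorm x <= sg.
  by move=> /sP[x0 rx]; split => //; exact: (NE1 N).
have h := rnorm_zprod_exp N_1 sg01 sgt PE sP'.
have -> : F t / a * G - 1 =
    (F t - (P N).[t]) / a * G + ((P N).[t] / a * G - 1) :> R[i].
  by rewrite mulrBl mulrBl addrA subrK.
rewrite (le_trans (ler_rnormD _ _))// (splitr e) lerD//; last exact: le_trans sgB.
rewrite !rnormM rnormV mulrAC ler_pdivrMr//.
apply: (@le_trans _ _ ((e / 2) * (rnorm a / (rnorm G + 1)) * (rnorm G + 1))).
  rewrite ler_pM ?rnorm_ge0 ?lerDl// hornerP.
  exact: le_trans (rnorm_egf_tail N (lexx _)) (NE2 _ N_3).
by rewrite -!mulrA mulVf ?mulr1// gt_eqF// ltr_wpDl// rnorm_ge0.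
Qed.

End exponential_type.
End hadamard.
(** * Functionals on a space of functions with bounded shifts *)
Section functionals.
Context {R : realType} {n : nat}.
Local Notation C := (Cplx R).
Context (Dhat : set 'rV[C]_n) (X : completeNormedModType R[i])
  (ev : {linear X -> (Dhat -> C)}).
Hypothesis ev_inj : injective ev.

Lemma ev_eq (f g : X) : (forall z, ev f z = ev g z) -> f = g.
Proof. by move=> fg; apply: ev_inj; apply/funext. Qed.

Lemma evD f g z : ev (f + g) z = ev f z + ev g z.
Proof. by rewrite raddfD. Qed.

Lemma evZ a f z : ev (a *: f) z = a * ev f z.
Proof. by rewrite linearZ_LR. Qed.

Lemma ev_sum I (s : seq I) (F : I -> X) z :
  ev (\sum_(i <- s) F i) z = \sum_(i <- s) ev (F i) z.
Proof.
elim: s => [|i s IH]; first by rewrite !big_nil raddf0.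
by rewrite !big_cons evD IH.
Qed.

Definition multiplier (S : X -> X) (s : Dhat -> C) (M : R) :=
  [/\ 0 <= M, forall f, rnorm (S f) <= M * rnorm f &
      forall f z, ev (S f) z = s z * ev f z].

Lemma ev_iter S s M k f z : multiplier S s M ->
  ev (iter k S f) z = s z ^+ k * ev f z.
Proof.
move=> [_ _ Ss]; elim: k => [|k IH] /=; first by rewrite expr0 mul1r.
by rewrite Ss IH exprS mulrA.
Qed.

Lemma rnorm_iter S s M k f : multiplier S s M ->
  rnorm (iter k S f) <= rnorm f * M ^+ k.
Proof.
move=> [M0 SM _]; elim: k => [|k IH] /=; first by rewrite expr0 mulr1.
by rewrite (le_trans (SM _))// exprS mulrCA ler_wpM2l.
Qed.

Lemma multiplier_sum (S : 'I_n -> X -> X) s M (w : 'I_n -> C) :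
  (forall i, multiplier (S i) (s i) (M i)) ->
  exists M', multiplier (fun f => \sum_i w i *: S i f)
                        (fun z => \sum_i w i * s i z) M'.
Proof.
move=> SM; have M0 : 0 <= \sum_i rnorm (w i) * M i.
  by apply: sumr_ge0 => i _; rewrite mulr_ge0 ?rnorm_ge0//; case: (SM i).
exists (\sum_i rnorm (w i) * M i); split => // f => [|z].
  rewrite (le_trans (ler_rnorm_sum _ _ _))// mulr_suml ler_sum// => i _.
  by rewrite rnormZ -mulrA ler_wpM2l ?rnorm_ge0//; case: (SM i).
rewrite ev_sum mulr_suml; apply: eq_bigr => i _.
by rewrite evZ; case: (SM i) => _ _ ->; rewrite mulrA.
Qed.

Hypothesis HQ2 : forall z : Dhat, exists2 L : {linear X -> C},
     bounded_linear L & forall f, L f = ev f z.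

(** The exponential series of a bounded multiplication converges in X by
    completeness, and its sum is the expected function because the evaluations
    are continuous. *)
Lemma exp_multiplier S s M f (t : C) : multiplier S s M ->
  exists2 g, (forall z, ev g z = cexp (t * s z) * ev f z) &
             egf (fun k => t ^+ k *: iter k S f) @ \oo --> g.
Proof.
move=> Sm; have M0 : 0 <= M by case: Sm.
have [|k|g gE] := @egf_lim_ex _ _ (fun k => t ^+ k *: iter k S f)
  (rnorm f) (rnorm t * M).
- by rewrite mulr_ge0 ?rnorm_ge0.
- rewrite rnormZ rnormX exprMn mulrCA ler_wpM2l ?exprn_ge0 ?rnorm_ge0//.
  exact: rnorm_iter Sm.
exists g => // z; have [L Lb LE] := HQ2 z.
rewrite -!LE; apply: (@cvg_unique _ (@norm_hausdorff _ C)
  (egf (L \o (fun k => t ^+ k *: iter k S f)) @ \oo)).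
  exact: (egf_linear (bounded_linear_cont Lb) gE).
rewrite LE; set c := ev f z.
have -> : egf (L \o (fun k => t ^+ k *: iter k S f)) =
    (fun N => egf (cpow (t * s z)) N * c).
  apply/funext => N; rewrite /egf mulr_suml; apply: eq_bigr => k _ /=.
  rewrite linearZ_LR LE (ev_iter k f z Sm) -/c /cpow exprMn.
  by rewrite -[RHS]scalerAl; congr (_ *: _); rewrite -mulrA.
apply: (@cvg_rnorm_squeeze _ _ _ _
  (fun N => exptail (rnorm (t * s z : C)) N * rnorm c)) => [N|].
  rewrite -mulrBl [leLHS]rnormM ler_wpM2r ?rnorm_ge0//.
  have := egf_lim_le (rnorm_ge0 _) (rnorm_cpow (t * s z)) (@egf_cpow _ (t * s z)) N.
  by rewrite mul1r.
by rewrite -(mul0r (rnorm c)); apply: cvgM; [exact: cvg_exptail|exact: cvg_cst].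
Qed.

Variables (S : 'I_n -> {linear X -> X}) (M : 'I_n -> R) (one : X).
Hypothesis SM : forall i, multiplier (S i) (coordfun Dhat i) (M i).
Hypothesis oneE : forall z, ev one z = 1.

Definition dotrow (w : 'rV[C]_n) (z : 'rV[C]_n) : C := \sum_i w 0 i * z 0 i.

Definition wshift (w : 'rV[C]_n) (f : X) : X := \sum_i w 0 i *: S i f.

Lemma wshift_multiplier w : exists Mw,
  multiplier (wshift w) (fun z => dotrow w (val z)) Mw.
Proof. exact: multiplier_sum. Qed.

Definition expfun_elt (w : 'rV[C]_n) : X := elt ev (expfun Dhat w).

Lemma ev_expfun_elt w : ev (expfun_elt w) = expfun Dhat w.
Proof.
have [Mw Sw] := wshift_multiplier w.
have [g gE _] := exp_multiplier one 1 Sw.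
have evg : ev g = expfun Dhat w.
  by apply/funext => z; rewrite gE oneE mulr1 mul1r.
by rewrite /expfun_elt (eltE ev_inj evg).
Qed.

Lemma expfun_elt0 : expfun_elt 0 = one.
Proof.
apply: ev_eq => z; rewrite ev_expfun_elt oneE /expfun big1 ?cexp0// => i _.
by rewrite mxE mul0r.
Qed.

Section functional.
Variables (L : {linear X -> C}) (K : R).
Hypothesis K0 : 0 <= K.
Hypothesis LK : forall f, rnorm (L f) <= K * rnorm f.

(** Restricted to a complex line, the exponentials are an exponential series,
    whose coefficients under L are the values of L on the iterated shifts. *)
Lemma egf_functional_line w v Mv :
  multiplier (wshift v) (fun z => dotrow v (val z)) Mv ->
  (forall k, rnorm (L (iter k (wshift v) (expfun_elt w))) <=
     K * rnorm (expfun_elt w) * Mv ^+ k) /\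
  forall t : C,
    egf (fun k => L (iter k (wshift v) (expfun_elt w)) * t ^+ k : C) @ \oo
    --> L (expfun_elt (w + t *: v)).
Proof.
move=> Sv; split=> [k|t].
  by rewrite (le_trans (LK _))// -mulrA ler_wpM2l//; exact: rnorm_iter Sv.
have [g gE gl] := exp_multiplier (expfun_elt w) t Sv.
have -> : expfun_elt (w + t *: v) = g.
  apply: ev_eq => z; rewrite gE !ev_expfun_elt /expfun -cexpD; congr cexp.
  rewrite /dotrow mulr_sumr -big_split/=; apply: eq_bigr => i _.
  by rewrite !mxE mulrDl mulrA addrC.
have -> : (fun k => L (iter k (wshift v) (expfun_elt w)) * t ^+ k : C) =
    L \o (fun k => t ^+ k *: iter k (wshift v) (expfun_elt w)).
  by apply/funext => k /=; rewrite linearZ_LR mulrC.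
exact: (egf_linear (bounded_linear_cont (rnorm_bounded_linear LK)) gl).
Qed.

Lemma functional_expfun : (forall w, L (expfun_elt w) != 0) ->
  forall w, L (expfun_elt w) =
    L one * cexp (dotrow w (\row_i (L (S i one) / L one))).
Proof.
move=> L0 w; have [Mw Sw] := wshift_multiplier w; have [Mw0 _ _] := Sw.
have [lamM FE] := egf_functional_line 0 Sw.
have := hadamard_exp_type Mw0 lamM FE (fun t => L0 _) 1.
rewrite add0r scale1r mul1r /= expfun_elt0 => ->; congr (_ * cexp _).
rewrite /dotrow /wshift linear_sum mulr_suml; apply: eq_bigr => i _.
by rewrite linearZ_LR mxE mulrA.
Qed.

(** The hypothesis, restricted to the line w + t e_i, equates two exponential
    series in t; their coefficients of degree one are the two sides. These are
    compared by means of the second-order remainders at small real t. *)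
Lemma functional_shift a b : (forall w, L (expfun_elt w) = a * cexp (dotrow w b)) ->
  forall i w, L (S i (expfun_elt w)) = a * b 0 i * cexp (dotrow w b).
Proof.
move=> LE i w; pose v : 'rV[C]_n := delta_mx 0 i.
have [Mv Sv] := wshift_multiplier v; have [Mv0 _ _] := Sv.
have SvE f : wshift v f = S i f.
  rewrite /wshift (bigD1 i)//= mxE !eqxx scale1r big1 ?addr0// => j ji.
  by rewrite mxE eqxx (negbTE ji) scale0r.
have vb : dotrow v b = b 0 i.
  rewrite /dotrow (bigD1 i)//= mxE !eqxx mul1r big1 ?addr0// => j ji.
  by rewrite mxE eqxx (negbTE ji) mul0r.
have dotrowD t : dotrow (w + t *: v) b = dotrow w b + t * b 0 i.
  rewrite -vb /dotrow mulr_sumr -big_split/=; apply: eq_bigr => j _.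
  by rewrite !mxE mulrDl mulrA.
have [lamM FE] := egf_functional_line w Sv.
set A := a * cexp (dotrow w b).
apply: subr0_eq; apply: rnorm_le_small => e e0.
rewrite mulrAC -/A.
pose c1 := K * rnorm (expfun_elt w) * (Mv ^+ 2 * expR Mv).
pose c2 := rnorm A * (rnorm (b 0 i) ^+ 2 * expR (rnorm (b 0 i))).
have small t : 0 < t <= 1 ->
    rnorm (L (S i (expfun_elt w)) - A * b 0 i : C) <= (c1 + c2) * t.
  move=> /andP[t0 t1]; pose tc := (t%:C%C : C).
  have rt : rnorm tc = t by rewrite rnorm_real gtr0_norm.
  have Mt0 : 0 <= Mv * t by rewrite mulr_ge0// ltW.
  have := rnorm_egf_tail Mv0 lamM FE 2 (t := tc) (r := t).
  rewrite rt => /(_ (lexx _)).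
  rewrite /egf big_nat_recr//= big_nat1 /= SvE (_ : 1`! = 1)%N// fact0 invr1.
  rewrite !scale1r expr0 expr1 mulr1 !LE dotrowD cexpD mulrA -/A => h1.
  have h2 := rnorm_cexp_sub1D (tc * b 0 i : C).
  have h3 : rnorm (A * (cexp (tc * b 0 i) - 1 - tc * b 0 i) : C) <= c2 * t ^+ 2.
    rewrite [leLHS]rnormM /c2 -[leRHS]mulrA ler_wpM2l ?rnorm_ge0// (le_trans h2)//.
    rewrite rnormM rt exprMn -[leLHS]mulrA [leRHS]mulrC ler_wpM2l ?exprn_ge0//.
      exact: ltW.
    rewrite ler_wpM2l ?exprn_ge0 ?rnorm_ge0// ler_expR.
    by rewrite ler_piMl ?rnorm_ge0.
  have h4 : K * rnorm (expfun_elt w) * exptail (Mv * t) 2 <= c1 * t ^+ 2.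
    rewrite /c1 -[leRHS]mulrA ler_wpM2l ?mulr_ge0 ?rnorm_ge0//.
    rewrite (le_trans (exptail2 Mt0))// exprMn mulrAC ler_wpM2r ?exprn_ge0 ?(ltW t0)//.
    rewrite ler_wpM2l ?exprn_ge0// ler_expR.
    by rewrite ler_piMr.
  rewrite -(ler_pM2l t0) -{1}rt -rnormM.
  have -> : tc * (L (S i (expfun_elt w)) - A * b 0 i) =
      A * (cexp (tc * b 0 i) - 1 - tc * b 0 i) -
      (A * cexp (tc * b 0 i) - (A + L (S i (expfun_elt w)) * tc)) :> R[i] by ring.
  rewrite (le_trans (ler_rnormB _ _))//.
  have -> : t * ((c1 + c2) * t) = c2 * t ^+ 2 + c1 * t ^+ 2 by ring.
  by rewrite lerD// (le_trans h1).
have c0 : 0 <= c1 + c2.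
  by rewrite addr_ge0// !mulr_ge0 ?exprn_ge0 ?rnorm_ge0 ?expR_ge0.
pose t := Num.min 1 (e / (c1 + c2 + 1)).
have c10 : 0 < c1 + c2 + 1 by rewrite ltr_wpDl.
have t0 : 0 < t by rewrite lt_min ltr01 divr_gt0.
have t01 : 0 < t <= 1 by rewrite t0 ge_min lexx.
rewrite (le_trans (small t t01))// (@le_trans _ _ ((c1 + c2 + 1) * t))//.
  by rewrite ler_wpM2r ?(ltW t0)// lerDl.
by rewrite mulrC -ler_pdivlMr// ge_min lexx orbT.
Qed.

End functional.

Definition shift_seq (s : seq 'I_n) (f : X) : X := foldr (fun i => S i) f s.

Lemma ev_shift_seq s f z :
  ev (shift_seq s f) z = (\prod_(i <- s) val z 0 i) * ev f z.
Proof.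
elim: s => [|i s IH] /=; first by rewrite big_nil mul1r.
by case: (SM i) => _ _ ->; rewrite IH big_cons mulrA.
Qed.

(** [functional_shift] makes the hypothesis pass from L to L \o S i, with a
    multiplied by b_i: shifts can be peeled off one at a time. *)
Lemma functional_shift_seq s (L : {linear X -> C}) (K : R) a b : 0 <= K ->
  (forall f, rnorm (L f) <= K * rnorm f) ->
  (forall w, L (expfun_elt w) = a * cexp (dotrow w b)) ->
  L (shift_seq s one) = a * \prod_(i <- s) b 0 i.
Proof.
elim: s L K a => [|i s IH] L K a K0 LK LE /=.
  rewrite big_nil mulr1 -expfun_elt0 LE /dotrow big1 ?cexp0 ?mulr1// => j _.
  by rewrite mxE mul0r.
have [Mi0 SMi _] := SM i.
have := IH (L \o S i) (K * M i) (a * b 0 i).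
rewrite big_cons mulrA => /= -> //; first exact: mulr_ge0.
- by move=> f; rewrite (le_trans (LK _))// -mulrA ler_wpM2l.
- exact: (functional_shift K0 LK LE).
Qed.

(** A monomial as the sequence of its variables, with repetitions: the order in
    which the shifts are applied to 1 to obtain it. *)
Definition mnmseq (m : 'I_n -> nat) : seq 'I_n :=
  flatten [seq nseq (m i) i | i <- enum 'I_n].

Lemma prod_mnmseq (m : 'I_n -> nat) (g : 'I_n -> C) :
  \prod_(i <- mnmseq m) g i = \prod_(i < n) g i ^+ m i.
Proof.
rewrite /mnmseq big_flatten big_map big_enum/=; apply: eq_bigr => i _.
by elim: (m i) => [|k IH]; rewrite ?big_nil//= big_cons IH exprS.
Qed.

Lemma functional_poly (L : {linear X -> C}) (K : R) a b : 0 <= K ->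
  (forall f, rnorm (L f) <= K * rnorm f) ->
  (forall w, L (expfun_elt w) = a * cexp (dotrow w b)) ->
  forall p f, ev f = polyfun Dhat p -> L f = a * mpoly.meval (b 0) p.
Proof.
move=> K0 LK LE p f fp.
have -> : f = \sum_(m <- mpoly.msupp p)
    mpoly.mcoeff m p *: shift_seq (mnmseq (mpoly.fun_of_multinom m)) one.
  apply: ev_eq => z; rewrite fp /polyfun mpoly.mevalE ev_sum.
  apply: eq_bigr => m _; rewrite evZ ev_shift_seq oneE mulr1 prod_mnmseq.
  by [].
rewrite linear_sum mpoly.mevalE mulr_sumr; apply: eq_bigr => m _.
rewrite linearZ_LR (functional_shift_seq _ K0 LK LE) prod_mnmseq.
by rewrite mulrCA.
Qed.

End functionals.
Theorem theorem4p1 (R : realType) (n : nat)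
  (Dhat D : set 'rV[Cplx R]_n) (openD : open D) (subD : D `<=` Dhat)
  (X : completeNormedModType R[i])
  (evX : {linear X -> (Dhat -> Cplx R)}) (evX_inj : injective evX)
  (analyticX : forall f : X, analytic_in D (evX f))
  (HQ : Q1_Q3 evX)
  (E : Type) (Y : topologicalLmodType R[i])
  (evY : {linear Y -> (E -> Cplx R)}) (evY_inj : injective evY)
  (evY_cont : forall u : E, continuous (fun g : Y => evY g u))
  (T : {linear X -> Y}) (T_cont : continuous T) :
  let nonvanishing (g : Y) := forall u : E, evY g u != 0 in
  let weighted_composition (a : Y) (b : E -> Dhat) :=
    nonvanishing a /\
    forall (f : X) (u : E), evY (T f) u = evY a u * evX f (b u) in
  ((forall w : 'rV[Cplx R]_n, nonvanishing (T (elt evX (expfun Dhat w))))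
   <-> (exists (a : Y) (b : E -> Dhat), weighted_composition a b))
  /\
  (forall (a : Y) (b : E -> Dhat), weighted_composition a b ->
     a = T (elt evX (fun=> 1)) /\
     forall (u : E) (i : 'I_n),
       val (b u) 0 i = evY (T (elt evX (coordfun Dhat i))) u
                       / evY (T (elt evX (fun=> 1))) u).
Proof.
move=> nonvanishing weighted_composition.
have [[Q1ex Q1dense] [Q2ev Q2poly] HQ3] := HQ.
have [one oneE] : exists one : X, forall z, evX one z = 1.
  have [one evone] := Q1ex (mpoly.mpolyC n 1); exists one => z.
  by rewrite evone /polyfun mpoly.mevalC.
have evone : evX one = fun=> 1 by apply/funext.
have one_elt : elt evX (fun=> 1) = one by exact: eltE.
have /choice[SM SME] : forall i, exists p : {linear X -> X} * R,
    multiplier evX p.1 (coordfun Dhat i) p.2.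
  move=> i; have [S /bounded_linear_rnorm[M M0 SM] SE] := HQ3 i.
  by exists (S, M).
pose S i := (SM i).1; pose M i := (SM i).2.
have Sone i : elt evX (coordfun Dhat i) = S i one.
  apply: eltE => //; apply/funext => z.
  by case: (SME i) => _ _ ->; rewrite oneE mulr1.
have evexp := ev_expfun_elt evX_inj Q2ev SME oneE.
split; last first.
  move=> a b [a0 Tab]; have aE : a = T one.
    by apply: evY_inj; apply/funext => u; rewrite Tab oneE mulr1.
  rewrite one_elt; split=> // u i; rewrite Sone Tab -aE.
  have [_ _ ->] := SME i.
  by rewrite oneE mulr1 [evY a u * _]mulrC mulfK.
split=> [nonvan|[a [b [a0 Tab]]] w u]; last first.
  by rewrite Tab evexp mulf_neq0// cexp_neq0.
have lin u : {L : {linear X -> Cplx R} | forall f, L f = evY (T f) u}.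
  have Ll : linear (fun f => evY (T f) u : Cplx R).
    by move=> k f g; rewrite !linearP.
  pose L : {linear X -> Cplx R} := HB.pack (fun f => evY (T f) u : Cplx R)
    (GRing.isLinear.Build _ _ _ _ _ Ll).
  by exists L.
have wc u : exists z : Dhat, forall f, evY (T f) u = evY (T one) u * evX f z.
  have [L LE] := lin u.
  have Lc : continuous L.
    have -> : (L : X -> Cplx R) = (fun g => evY g u) \o T by apply/funext.
    by move=> f; apply: continuous_comp; [exact: T_cont|exact: evY_cont].
  have [K K0 LK] := continuous_linear_rnorm Lc.
  have L0 w : L (expfun_elt evX w) != 0 by rewrite LE; exact: nonvan.
  have Lexp := functional_expfun evX_inj Q2ev SME oneE K0 LK L0.
  set b := \row_i _ in Lexp.
  have Lone : L one != 0 by rewrite -(expfun_elt0 evX_inj Q2ev SME oneE).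
  have Lpoly := functional_poly evX_inj Q2ev SME oneE K0 LK Lexp.
  have bD : Dhat b.
    apply: Q2poly; exists ((L one)^-1 \*: L) => [|p f /Lpoly /= ->].
      apply: (@rnorm_bounded_linear _ _ _ _ (rnorm ((L one)^-1 : Cplx R) * K)) => f.
      by rewrite /= rnormZ -mulrA ler_wpM2l ?rnorm_ge0.
    by rewrite /GRing.scale/= mulKf.
  pose z : Dhat := exist _ b (mem_set bD).
  have [Lz Lzb LzE] := Q2ev z.
  have [Kz Kz0 LzK] := bounded_linear_rnorm Lzb.
  exists z => f; rewrite -!LE -LzE.
  apply: subr0_eq; apply: rnorm_le_small => e e0.
  pose B := K + rnorm (L one) * Kz.
  have B0 : 0 <= B by rewrite addr_ge0// mulr_ge0// rnorm_ge0.
  have B1 : 0 < B + 1 by rewrite ltr_wpDl.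
  have [g [p gp] fg] := dense_rnorm f Q1dense (divr_gt0 e0 B1).
  have -> : L f - L one * Lz f = L (f - g) - L one * Lz (f - g).
    have Lg : L g = L one * Lz g by rewrite (Lpoly _ _ gp) LzE gp.
    by rewrite !raddfB/= mulrBr Lg opprB addrA subrK.
  rewrite (le_trans (ler_rnormB _ _))// rnormM.
  apply: (@le_trans _ _ (B * rnorm (f - g))).
    by rewrite mulrDl lerD// -mulrA ler_wpM2l ?rnorm_ge0.
  apply: (@le_trans _ _ ((B + 1) * rnorm (f - g))).
    by rewrite ler_wpM2r ?rnorm_ge0// lerDl.
  by rewrite mulrC -ler_pdivlMr// ltW.
have /choice[b bE] := wc.
exists (T one), b; split=> // u.
by rewrite -(expfun_elt0 evX_inj Q2ev SME oneE); exact: nonvan.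
Qed.
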